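(* Let $\mathbf K\in\mathbb R^{N\times N}$ satisfy $\|\mathbf K\|_2=\kappa<1$, let $\mathcal R\in\mathbb R^{N\times r}$ satisfy $\mathcal R^\top\mathcal R=I_r$, and let $\boldsymbol\phi\in\mathbb R^N$. For the Galerkin reduced-order model $(I_r-\widehat{\mathbf K})c=\mathcal R^\top\boldsymbol\phi$, with $\widehat{\mathbf K}=\mathcal R^\top\mathbf K\mathcal R\in\mathbb R^{r\times r}$, one has $\|\widehat{\mathbf K}\|_2\le\|\mathbf K\|_2=\kappa<1$. Hence $I_r-\widehat{\mathbf K}$ is invertible with $$\|(I_r-\widehat{\mathbf K})^{-1}\|_2\le(1-\kappa)^{-1},$$ and the reduced solution is unique and uniformly bounded (in terms of the data, with a constant depending only on $\kappa$).
   Context: $\|\cdot\|_2$ is the Euclidean norm on vectors and the induced operator norm on matrices. In the paper, $\mathbf K$ is the full-order discretization of a contractive second-kind Fredholm integral operator, $\kappa$ is its discrete contraction constant, and the columns of $\mathcal R$ form a POD basis; the reduced density is $\widehat U=\mathcal R c$. *)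

(* Defs.v *)
From HB Require Import structures.
From mathcomp Require Import all_boot all_order all_algebra.
From mathcomp Require Import boolp classical_sets reals.

Set Implicit Arguments.
Unset Strict Implicit.
Unset Printing Implicit Defensive.

Import Order.TTheory GRing.Theory Num.Theory.

Local Open Scope classical_set_scope.
Local Open Scope ring_scope.

(* The library norm `|x| on matrices is the entrywise maximum, so the Euclidean
   norm and the operator norm it induces are defined here. *)
Definition l2norm (R : realType) (n : nat) (x : 'cV[R]_n) : R :=
  Num.sqrt (\sum_(i < n) x i 0 ^+ 2).

(* The supremum is over the closed unit ball rather than the unit sphere, so
   that the set is nonempty also when n = 0 ([sup set0] would be a junk value);
   the set is always bounded, so this is a genuine least upper bound. *)
Definition opnorm2 (R : realType) (m n : nat) (A : 'M[R]_(m, n)) : R :=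
  sup [set l2norm (A *m x) | x in [set x : 'cV[R]_n | l2norm x <= 1]].

Definition reduced_mx (R : realType) (N r : nat)
    (K : 'M[R]_N) (B : 'M[R]_(N, r)) : 'M[R]_r :=
  B^T *m K *m B.

Definition galerkin_rom (R : realType) (N r : nat) (K : 'M[R]_N)
    (B : 'M[R]_(N, r)) (phi : 'cV[R]_N) (c : 'cV[R]_r) : Prop :=
  (1%:M - reduced_mx K B) *m c = B^T *m phi.

(* Main.v *)
Require Import Defs.
From HB Require Import structures.
From mathcomp Require Import all_boot all_order all_algebra.
From mathcomp Require Import boolp classical_sets reals.
From mathcomp Require Import ring.

(** Since the columns of [B] are orthonormal, [B] is an isometry and [B^T] is a
    contraction for the Euclidean norm ([l2norm_isometry],
    [l2norm_tr_contraction]), so compressing [K] to [B^T *m K *m B] cannot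
    increase its operator norm. The triangle inequality then gives
    [(1 - kappa) * l2norm c <= l2norm ((1%:M - M) *m c)] for the compressed
    matrix [M] ([l2norm_sub1_ge]). This single coercivity estimate makes
    [1%:M - M] injective, hence invertible, and bounds its inverse, and with it
    the solution, by [(1 - kappa)^-1].

    The supremum defining [opnorm2] is used only through its two
    characteristic properties: it is a Lipschitz constant ([l2norm_mulmx_le]),
    and it lies below every nonnegative Lipschitz constant ([opnorm2_le]).
    The first one needs the supremum to be over a bounded set, which follows
    from the Cauchy-Schwarz inequality applied row by row. *)

Import Order.TTheory GRing.Theory Num.Theory.

Local Open Scope classical_set_scope.
Local Open Scope ring_scope.

Section Euclidean.

Set Implicit Arguments.
Unset Strict Implicit.
Unset Printing Implicit Defensive.

Variable R : realType.
Implicit Types m n : nat.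

(** The Euclidean inner product of two column vectors. *)
Definition dotv n (x y : 'cV[R]_n) : R := (x^T *m y) 0 0.

Lemma dotvE n (x y : 'cV[R]_n) : dotv x y = \sum_(i < n) x i 0 * y i 0.
Proof. by rewrite /dotv mxE; apply: eq_bigr => i _; rewrite mxE. Qed.

Lemma dotvC n (x y : 'cV[R]_n) : dotv x y = dotv y x.
Proof. by rewrite !dotvE; apply: eq_bigr => i _; rewrite mulrC. Qed.

Lemma dotvDr n (x y z : 'cV[R]_n) : dotv x (y + z) = dotv x y + dotv x z.
Proof. by rewrite /dotv mulmxDr mxE. Qed.

Lemma dotvZr n a (x y : 'cV[R]_n) : dotv x (a *: y) = a * dotv x y.
Proof. by rewrite /dotv -scalemxAr mxE. Qed.

Lemma dotvDl n (x y z : 'cV[R]_n) : dotv (x + y) z = dotv x z + dotv y z.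
Proof. by rewrite dotvC dotvDr (dotvC z x) (dotvC z y). Qed.

Lemma dotvZl n a (x y : 'cV[R]_n) : dotv (a *: x) y = a * dotv x y.
Proof. by rewrite dotvC dotvZr (dotvC y x). Qed.

Lemma dotv_mulmxl m n (A : 'M[R]_(m, n)) x y :
  dotv (A *m x) y = dotv x (A^T *m y).
Proof. by rewrite /dotv trmx_mul mulmxA. Qed.

Lemma dotv_ge0 n (x : 'cV[R]_n) : 0 <= dotv x x.
Proof. by rewrite dotvE; apply: sumr_ge0 => i _; rewrite -expr2 sqr_ge0. Qed.

Lemma dotv_eq0 n (x : 'cV[R]_n) : dotv x x = 0 -> x = 0.
Proof.
rewrite dotvE => /eqP; rewrite psumr_eq0; last first.
  by move=> i _; rewrite -expr2 sqr_ge0.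
move=> /allP x0; apply/colP => i; rewrite mxE.
have := x0 i (mem_index_enum i).
by rewrite /= -expr2 sqrf_eq0 => /eqP.
Qed.

Lemma l2normE n (x : 'cV[R]_n) : l2norm x = Num.sqrt (dotv x x).
Proof. by rewrite dotvE /l2norm; under eq_bigr do rewrite expr2. Qed.

Lemma l2norm_ge0 n (x : 'cV[R]_n) : 0 <= l2norm x.
Proof. exact: sqrtr_ge0. Qed.

Lemma l2norm_sqr n (x : 'cV[R]_n) : l2norm x ^+ 2 = dotv x x.
Proof. by rewrite l2normE sqr_sqrtr // dotv_ge0. Qed.

Lemma l2norm_eq0 n (x : 'cV[R]_n) : l2norm x = 0 -> x = 0.
Proof. by move=> x0; apply: dotv_eq0; rewrite -l2norm_sqr x0 expr0n. Qed.

Lemma l2norm0 n : l2norm (0 : 'cV[R]_n) = 0.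
Proof. by rewrite l2normE dotvE big1 ?sqrtr0 // => i _; rewrite mxE mul0r. Qed.

Lemma l2normZ n a (x : 'cV[R]_n) : l2norm (a *: x) = `|a| * l2norm x.
Proof.
rewrite !l2normE dotvZl dotvZr mulrA -expr2.
by rewrite sqrtrM ?sqr_ge0 // sqrtr_sqr.
Qed.

Lemma cauchy_schwarz_sqr n (x y : 'cV[R]_n) :
  dotv x y ^+ 2 <= dotv x x * dotv y y.
Proof.
have [y0|y0] := eqVneq (dotv y y) 0.
  by rewrite (dotv_eq0 y0) /dotv !mulmx0 mxE expr0n mulr0.
have ygt0 : 0 < dotv y y by rewrite lt_def y0 dotv_ge0.
(* Up to the factor [dotv y y], this vector is the component of [x]
   orthogonal to [y]. *)
have := dotv_ge0 (dotv y y *: x + - dotv x y *: y).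
suff -> : dotv (dotv y y *: x + - dotv x y *: y)
               (dotv y y *: x + - dotv x y *: y)
          = dotv y y * (dotv x x * dotv y y - dotv x y ^+ 2).
  by rewrite pmulr_rge0 // subr_ge0.
by rewrite !(dotvDl, dotvDr, dotvZl, dotvZr) (dotvC y x); ring.
Qed.

Lemma cauchy_schwarz n (x y : 'cV[R]_n) : dotv x y <= l2norm x * l2norm y.
Proof.
apply: (le_trans (ler_norm _)).
rewrite -(ler_pXn2r (ltn0Sn 1)) ?nnegrE ?normr_ge0 ?mulr_ge0 ?l2norm_ge0 //.
by rewrite real_normK ?num_real // exprMn !l2norm_sqr cauchy_schwarz_sqr.
Qed.

Lemma l2normD n (x y : 'cV[R]_n) : l2norm (x + y) <= l2norm x + l2norm y.
Proof.
rewrite -(ler_pXn2r (ltn0Sn 1)) ?nnegrE ?addr_ge0 ?l2norm_ge0 //.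
rewrite sqrrD !l2norm_sqr dotvDl !dotvDr (dotvC y x) addrA lerD2r -addrA lerD2l.
by rewrite -mulr2n lerMn2r cauchy_schwarz.
Qed.

(** The Lipschitz constant obtained here is the Frobenius norm of [A]. *)
Lemma l2norm_mulmx_bounded m n (A : 'M[R]_(m, n)) :
  exists2 C, 0 <= C & forall x, l2norm (A *m x) <= C * l2norm x.
Proof.
set F := \sum_(i < m) dotv (row i A)^T (row i A)^T.
have F0 : 0 <= F by apply: sumr_ge0 => i _; exact: dotv_ge0.
exists (Num.sqrt F) => [|x]; first exact: sqrtr_ge0.
rewrite !l2normE -sqrtrM // ler_sqrt ?mulr_ge0 ?dotv_ge0 // dotvE mulr_suml.
apply: ler_sum => i _; rewrite -expr2.
have -> : (A *m x) i 0 = dotv (row i A)^T x.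
  by rewrite /dotv trmxK -row_mul [RHS]mxE.
exact: cauchy_schwarz_sqr.
Qed.

Lemma has_sup_opnorm2 m n (A : 'M[R]_(m, n)) :
  has_sup [set l2norm (A *m x) | x in [set x : 'cV[R]_n | l2norm x <= 1]].
Proof.
split; first by exists (l2norm (A *m 0)), 0; rewrite //= l2norm0 ler01.
have [C C0 AC] := l2norm_mulmx_bounded A.
exists C => _ [x /= x1 <-]; apply: (le_trans (AC x)).
by rewrite ler_piMr.
Qed.

Lemma l2norm_mulmx_unit_ball m n (A : 'M[R]_(m, n)) (x : 'cV[R]_n) :
  l2norm x <= 1 -> l2norm (A *m x) <= opnorm2 A.
Proof.
by move=> x1; apply: (sup_upper_bound (has_sup_opnorm2 A)); exists x.
Qed.

Lemma opnorm2_ge0 m n (A : 'M[R]_(m, n)) : 0 <= opnorm2 A.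
Proof.
apply: (le_trans (l2norm_ge0 (A *m 0))).
by apply: l2norm_mulmx_unit_ball; rewrite l2norm0 ler01.
Qed.

Lemma l2norm_mulmx_le m n (A : 'M[R]_(m, n)) (x : 'cV[R]_n) :
  l2norm (A *m x) <= opnorm2 A * l2norm x.
Proof.
have [x0|x0] := eqVneq (l2norm x) 0.
  by rewrite (l2norm_eq0 x0) mulmx0 !l2norm0 mulr0.
have xgt0 : 0 < l2norm x by rewrite lt_def x0 l2norm_ge0.
rewrite -ler_pdivrMr // mulrC.
have -> : (l2norm x)^-1 * l2norm (A *m x) = l2norm (A *m ((l2norm x)^-1 *: x)).
  by rewrite -scalemxAr l2normZ ger0_norm // invr_ge0 l2norm_ge0.
apply: l2norm_mulmx_unit_ball.
by rewrite l2normZ ger0_norm ?invr_ge0 ?l2norm_ge0 // mulVf.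
Qed.

Lemma opnorm2_le m n (A : 'M[R]_(m, n)) C :
  0 <= C -> (forall x, l2norm (A *m x) <= C * l2norm x) -> opnorm2 A <= C.
Proof.
move=> C0 AC; apply: ge_sup; first by case: (has_sup_opnorm2 A).
move=> _ [x /= x1 <-]; apply: (le_trans (AC x)).
by rewrite ler_piMr.
Qed.

Lemma l2norm_isometry m n (B : 'M[R]_(m, n)) (x : 'cV[R]_n) :
  B^T *m B = 1%:M -> l2norm (B *m x) = l2norm x.
Proof. by move=> BB; rewrite !l2normE dotv_mulmxl mulmxA BB mul1mx. Qed.

Lemma l2norm_tr_contraction m n (B : 'M[R]_(m, n)) (y : 'cV[R]_m) :
  B^T *m B = 1%:M -> l2norm (B^T *m y) <= l2norm y.
Proof.
move=> BB; have [z0|z0] := eqVneq (l2norm (B^T *m y)) 0.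
  by rewrite z0 l2norm_ge0.
have zgt0 : 0 < l2norm (B^T *m y) by rewrite lt_def z0 l2norm_ge0.
(* The squared norm of [B^T *m y] is the inner product of [y] with its
   projection [B *m (B^T *m y)], whose norm is that of [B^T *m y]. *)
rewrite -(ler_pM2r zgt0) -expr2 l2norm_sqr dotv_mulmxl trmxK.
by rewrite -(l2norm_isometry (B^T *m y) BB) cauchy_schwarz.
Qed.

Lemma opnorm2_compression m n (K : 'M[R]_m) (B : 'M[R]_(m, n)) :
  B^T *m B = 1%:M -> opnorm2 (B^T *m K *m B) <= opnorm2 K.
Proof.
move=> BB; apply: opnorm2_le => [|x]; first exact: opnorm2_ge0.
rewrite -!mulmxA; apply: (le_trans (l2norm_tr_contraction _ BB)).
by rewrite -(l2norm_isometry x BB) l2norm_mulmx_le.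
Qed.

(** Coercivity of [1%:M - M] when [kappa < 1]. *)
Lemma l2norm_sub1_ge n (M : 'M[R]_n) kappa (c : 'cV[R]_n) :
  opnorm2 M <= kappa ->
  (1 - kappa) * l2norm c <= l2norm ((1%:M - M) *m c).
Proof.
move=> Mk; rewrite mulrBl mul1r lerBlDr.
have {1}-> : c = (1%:M - M) *m c + M *m c by rewrite -mulmxDl subrK mul1mx.
apply: (le_trans (l2normD _ _)); rewrite lerD2l.
apply: (le_trans (l2norm_mulmx_le _ _)).
by rewrite ler_wpM2r // l2norm_ge0.
Qed.

Lemma l2norm_le_sub1 n (M : 'M[R]_n) kappa (c : 'cV[R]_n) :
  opnorm2 M <= kappa -> kappa < 1 ->
  l2norm c <= (1 - kappa)^-1 * l2norm ((1%:M - M) *m c).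
Proof.
move=> Mk k1; rewrite mulrC ler_pdivlMr ?subr_gt0 // mulrC.
exact: l2norm_sub1_ge.
Qed.

Lemma sub1_unitmx n (M : 'M[R]_n) : opnorm2 M < 1 -> 1%:M - M \in unitmx.
Proof.
move=> M1; rewrite -unitmx_tr -row_free_unit; apply: inj_row_free => v v0.
apply: trmx_inj; rewrite trmx0; apply: l2norm_eq0; apply/eqP.
rewrite eq_le l2norm_ge0 andbT.
apply: (le_trans (l2norm_le_sub1 _ (lexx _) M1)).
by rewrite -[1%:M - M]trmxK -trmx_mul v0 trmx0 l2norm0 mulr0.
Qed.

Lemma opnorm2_invmx_sub1 n (M : 'M[R]_n) kappa :
  opnorm2 M <= kappa -> kappa < 1 ->
  opnorm2 (invmx (1%:M - M)) <= (1 - kappa)^-1.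
Proof.
move=> Mk k1; apply: opnorm2_le => [|y].
  by rewrite invr_ge0 subr_ge0 ltW.
apply: (le_trans (l2norm_le_sub1 _ Mk k1)).
by rewrite mulKVmx // sub1_unitmx // (le_lt_trans Mk).
Qed.

End Euclidean.

Theorem proposition3p1 (R : realType) (N r : nat) (kappa : R)
    (K : 'M[R]_N) (B : 'M[R]_(N, r)) (phi : 'cV[R]_N)
    (normK : opnorm2 K = kappa) (kappa_lt1 : kappa < 1)
    (orthB : B^T *m B = 1%:M) :
  [/\ opnorm2 (reduced_mx K B) <= opnorm2 K /\ opnorm2 (reduced_mx K B) < 1,
      1%:M - reduced_mx K B \in unitmx,
      opnorm2 (invmx (1%:M - reduced_mx K B)) <= (1 - kappa)^-1,
      exists! c : 'cV[R]_r, galerkin_rom K B phi c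
    & forall c : 'cV[R]_r, galerkin_rom K B phi c ->
        l2norm c <= (1 - kappa)^-1 * l2norm phi /\
        l2norm (B *m c) <= (1 - kappa)^-1 * l2norm phi].
Proof.
have MK : opnorm2 (reduced_mx K B) <= opnorm2 K by exact: opnorm2_compression.
have Mk : opnorm2 (reduced_mx K B) <= kappa by rewrite -normK.
have M1 := le_lt_trans Mk kappa_lt1.
have uM := sub1_unitmx M1.
split=> //.
- exact: opnorm2_invmx_sub1.
- exists (invmx (1%:M - reduced_mx K B) *m (B^T *m phi)).
  split=> [|c cP]; first by rewrite /galerkin_rom mulKVmx.
  by rewrite -cP mulKmx.
- move=> c cP; rewrite l2norm_isometry //.
  suff : l2norm c <= (1 - kappa)^-1 * l2norm phi by [].
  apply: (le_trans (l2norm_le_sub1 c Mk kappa_lt1)).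
  rewrite cP ler_wpM2l ?invr_ge0 ?subr_ge0 ?(ltW kappa_lt1) //.
  exact: l2norm_tr_contraction.
Qed.
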